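(* Let $X$ be a strictly convex reflexive Banach space of dimension at least $2$, let $S\subseteq X$ be a dense set, and let $T:S\to S$ be a step-isometry on $S$. Then $T$ is an isometry, i.e. $\|T(x)-T(y)\|=\|x-y\|$ for all $x,y\in S$.
   Context: All normed spaces are real. Let $S$ be a dense set in a normed space $X$. A bijection $T:S\to S$ is a step-isometry (on $S$) if for all $x,y\in S$ we have $\lfloor\|x-y\|\rfloor=\lfloor\|T(x)-T(y)\|\rfloor$; equivalently, for every positive integer $k$ and all $x,y\in S$, $\|x-y\|<k$ if and only if $\|T(x)-T(y)\|<k$. $X$ is strictly convex if every point of the unit sphere is an extreme point of the closed unit ball. The set $S$ is not assumed countable. *)

(* Defs.v *)
From HB Require Import structures.
From mathcomp Require Import all_boot all_order all_algebra.
From mathcomp Require Import all_classical all_reals all_analysis.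
Set Implicit Arguments.
Unset Strict Implicit.
Unset Printing Implicit Defensive.
Import Order.TTheory GRing.Theory Num.Theory.
Import numFieldNormedType.Exports.
Local Open Scope classical_set_scope.
Local Open Scope ring_scope.

Section dual_space.
Context {R : realType} (X : normedModType R).

Definition continuous_functional : {pred X -> R^o} :=
  [pred f : X -> R^o | `[< linear f /\ continuous f >]].

Record dual := Dual {
  dual_fun :> X -> R^o ;
  _ : dual_fun \in continuous_functional }.

HB.instance Definition _ := [isSub for dual_fun].
HB.instance Definition _ := [Choice of dual by <:].

Lemma continuous_functional_submod_closed : submod_closed continuous_functional.
Proof.
split=> [|a f g]; rewrite !inE /=.
  split=> [b x y|]; last exact: cst_continuous.
  by rewrite /= scaler0 addr0.
move=> [lf cf] [lg cg]; split=> [b x y|x]; last first.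
  by apply: continuousD; [apply: continuousZl_tmp|]; [exact: cf|exact: cg].
by rewrite /= !fctE lf lg !scalerDr !scalerA [a * b]mulrC addrACA.
Qed.
HB.instance Definition _ := GRing.isSubmodClosed.Build _ _
  continuous_functional continuous_functional_submod_closed.
HB.instance Definition _ := [SubChoice_isSubLmodule of dual by <:].

Lemma dual_addE (f g : dual) x : (f + g) x = f x + g x. Proof. by []. Qed.

Lemma dual_scaleE a (f : dual) x : (a *: f) x = a * f x. Proof. by []. Qed.

Lemma dual_linear (f : dual) : linear f.
Proof. by case: f => f /=; rewrite inE => -[]. Qed.

Lemma dual_continuous (f : dual) : continuous f.
Proof. by case: f => f /=; rewrite inE => -[]. Qed.

HB.instance Definition _ (f : dual) :=
  GRing.isLinear.Build R X R^o _ f (dual_linear f).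

Definition dual_norm (f : dual) : R :=
  sup [set `|f x| | x in [set x : X | `|x| <= 1]].

Lemma dual_norm_has_sup (f : dual) :
  has_sup [set `|f x| | x in [set x : X | `|x| <= 1]].
Proof.
split; first by exists `|f 0|, 0 => //=; rewrite normr0.
have /bounded_funP/(_ 1)[M fM] :=
  (linear_bounded_continuous f).2 (@dual_continuous f).
by exists M => _ [x /= x1 <-]; exact: fM.
Qed.

Lemma dual_norm_ub (f : dual) x : `|x| <= 1 -> `|f x| <= dual_norm f.
Proof.
by move=> x1; apply: ub_le_sup; [exact: (dual_norm_has_sup f).2|exists x].
Qed.

Lemma dual_norm_ge0 (f : dual) : 0 <= dual_norm f.
Proof. by rewrite (le_trans (normr_ge0 (f 0)))// dual_norm_ub// normr0. Qed.

Lemma dual_norm_le (f : dual) x : `|f x| <= dual_norm f * `|x|.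
Proof.
have [->|x0] := eqVneq x 0; first by rewrite linear0 !normr0 mulr0.
have nx0 : 0 < `|x| by rewrite normr_gt0.
have : `|f (`|x|^-1 *: x)| <= dual_norm f.
  by apply: dual_norm_ub; rewrite normrZ gtr0_norm ?invr_gt0// mulVf// gt_eqF.
by rewrite linearZ/= normrZ gtr0_norm ?invr_gt0// ler_pdivrMl// mulrC.
Qed.

Lemma dual_norm_le_ub (f : dual) M :
  (forall x, `|x| <= 1 -> `|f x| <= M) -> dual_norm f <= M.
Proof.
move=> fM; apply: ge_sup; first exact: (dual_norm_has_sup f).1.
by move=> _ [x /= x1 <-]; exact: fM.
Qed.

Lemma dual_normD (f g : dual) : dual_norm (f + g) <= dual_norm f + dual_norm g.
Proof.
apply: dual_norm_le_ub => x x1; rewrite dual_addE.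
by rewrite (le_trans (ler_normD _ _))// lerD// dual_norm_ub.
Qed.

Lemma dual_normZ a (f : dual) : dual_norm (a *: f) = `|a| * dual_norm f.
Proof.
have le b g : dual_norm (b *: g) <= `|b| * dual_norm g.
  apply: dual_norm_le_ub => x x1.
  by rewrite dual_scaleE normrM ler_wpM2l// dual_norm_ub.
have [->|a0] := eqVneq a 0.
  rewrite normr0 mul0r; apply/eqP; rewrite eq_le dual_norm_ge0 andbT.
  by rewrite (le_trans (le _ _))// normr0 mul0r.
apply/eqP; rewrite eq_le le/= -ler_pdivlMl ?normr_gt0//.
by rewrite -normfV -{1}[f](scalerK a0) le.
Qed.

Lemma dual_norm0_eq0 (f : dual) : dual_norm f = 0 -> f = 0.
Proof.
move=> f0; apply/val_inj/funext => x /=.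
by apply/eqP; rewrite -normr_le0 (le_trans (dual_norm_le f x))// f0 mul0r.
Qed.

HB.instance Definition _ :=
  Lmodule_isNormed.Build R dual dual_normD dual_normZ dual_norm0_eq0.

Lemma dual_normE (f : dual) : `|f| = dual_norm f. Proof. by []. Qed.

End dual_space.
Arguments continuous_functional {R} X.

Section reflexivity.
Context {R : realType} (X : normedModType R).

Lemma bidual_eval_subproof (x : X) :
  (fun f : dual X => f x : R^o) \in continuous_functional (dual X).
Proof.
have ex_linear : linear (fun f : dual X => f x : R^o) by [].
rewrite inE /=; split=> //.
pose ev : {linear dual X -> R^o} := HB.pack (fun f : dual X => f x : R^o)
  (GRing.isLinear.Build _ _ _ _ _ ex_linear).
apply/(linear_bounded_continuous ev)/bounded_funP => r.
exists (r * `|x|) => f fr; rewrite (le_trans (dual_norm_le f x))//.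
by rewrite ler_wpM2r.
Qed.

Definition bidual_eval (x : X) : dual (dual X) := Dual (bidual_eval_subproof x).

Definition reflexive_space := forall Phi : dual (dual X),
  exists x : X, bidual_eval x = Phi.

End reflexivity.

Definition extreme_point {R : realType} {V : lmodType R} (A : set V) (x : V) :=
  A x /\ forall (y z : V) (t : R), A y -> A z -> 0 < t < 1 ->
    x = t *: y + (1 - t) *: z -> y = x /\ z = x.

Definition strictly_convex {R : realType} (X : normedModType R) :=
  forall x : X, `|x| = 1 -> extreme_point [set y : X | `|y| <= 1] x.

Definition linearly_independent {R : realType} {V : lmodType R} {n : nat}
    (e : 'I_n -> V) :=
  forall c : 'I_n -> R, \sum_(i < n) c i *: e i = 0 -> forall i, c i = 0.

Definition dimension_ge {R : realType} (V : lmodType R) (n : nat) :=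
  exists e : 'I_n -> V, linearly_independent e.

(* T is a self-map of S given by an ambient function; its values outside of S
   are irrelevant. *)
Definition step_isometry {R : realType} {X : normedModType R}
    (S : set X) (T : X -> X) :=
  set_bij S S T /\
  forall x y, S x -> S y -> Num.floor `|x - y| = Num.floor `|T x - T y|.

(* Main.v *)
(** Set V x = lim T^-1(2^n x) / 2^n, with T^-1 extended to X by nearby points of
    S: the limit exists by Vaisala's proof of the Mazur-Ulam theorem run with
    error terms, and V is isometric with V (T x) = x + o(|x|). So let T x = x + o(|x|).
    Looking at x and y from far away points of S in the direction -u, the integer
    thresholds of the distance turn into f x + n < f y -> f (T x) + n <= f (T y)
    for some functional f norming u. No smoothness of the norm at u is needed:
    along finitely many directions the norm is almost smooth at points arbitrarily
    close to u, and f is an ultrafilter limit over finite sets of directions.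
    Taking n near f y - f x shows that T x - x is bounded, and n = 0 that f (T x) is
    a monotone function of f x, up to its jumps.
    Fix u and let f n norm points u_n -> u that are not multiples of u. By strict
    convexity no f n is a multiple of their limit F. Moving x inside the kernels of
    the f n while F x changes, and taking weak limits (reflexivity), shows that
    F (T x - x) is constant. For u = x - y this gives |x - y| <= |T x - T y|, and
    the same for T^-1. *)

Require Import Defs.
From HB Require Import structures.
From mathcomp Require Import all_boot all_order all_algebra.
From mathcomp Require Import all_classical all_reals all_analysis.
From mathcomp Require Import ring lra.
Import Order.TTheory GRing.Theory Num.Theory.
Import numFieldNormedType.Exports.
Local Open Scope classical_set_scope.
Local Open Scope ring_scope.

(** * Almost smooth points of the norm and flat cones *)

Lemma second_difference_telescope (R : realType) (g : nat -> R) (c : R) N :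
  (forall j, (j < N)%N -> c <= g j.+2 + g j - 2 * g j.+1) ->
  N%:R * c <= g N.+1 - g N - (g 1%N - g 0%N).
Proof.
elim: N => [|N IH] gc; first by lra.
have := gc N (ltnSn N); have := IH (fun j jN => gc j (ltnW jN)).
rewrite -natr1 mulrDl; lra.
Qed.

(** Otherwise the increments of the norm over [N] steps of size [d] along [w] would grow by at least
    [N%:R * eta * d], more than the [2 * |w| * d] that the triangle inequality allows. *)
Lemma small_second_difference (R : realType) (X : normedModType R) (u w : X)
    (eta rho : R) : 0 < eta -> 0 < rho -> exists t d : R,
  [/\ 0 < d, `|t *: w| <= rho &
   `|u + t *: w + d *: w| + `|u + t *: w - d *: w| - 2 * `|u + t *: w|
     <= eta * d].
Proof.
move=> eta0 rho0; have rho0' := ltW rho0; pose N := Num.bound (2 * `|w| / eta).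
have Nw : 2 * `|w| < N%:R * eta.
  by rewrite -ltr_pdivrMr//; apply: archi_boundP; rewrite divr_ge0// ltW.
have w1 : 0 < `|w| + 1 by rewrite ltr_pwDr.
have N0 : 0 < N.+1%:R :> R by [].
(* This scale keeps all the points [j.+1%:R * d *: w] with [j < N] within [rho], also when
   [w = 0]. *)
pose d := rho / N.+1%:R / (`|w| + 1).
have d0 : 0 < d by rewrite !divr_gt0.
have [//|nex] := pselect (exists t d : R,
  [/\ 0 < d, `|t *: w| <= rho &
   `|u + t *: w + d *: w| + `|u + t *: w - d *: w| - 2 * `|u + t *: w|
     <= eta * d]).
pose g j := `|u + (j%:R * d) *: w|.
have gS j : `|g j.+1 - g j| <= d * `|w|.
  rewrite (le_trans (ler_dist_dist _ _))//.
  rewrite opprD addrACA subrr add0r -scalerBl -mulrBl -natr1 addrAC subrr add0r.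
  by rewrite mul1r normrZ gtr0_norm.
have := @second_difference_telescope R g (eta * d) N.
have gc j : (j < N)%N -> eta * d <= g j.+2 + g j - 2 * g j.+1.
  move=> jN; rewrite leNgt; apply/negP => lt; apply: nex.
  exists (j.+1%:R * d), d; split => //.
    rewrite normrZ ger0_norm ?mulr_ge0// ?(ltW d0)//.
    have -> : j.+1%:R * d * `|w| = rho * ((j.+1%:R / N.+1%:R) * (`|w| / (`|w| + 1))).
      by rewrite /d; field; rewrite !gt_eqF//=; lra.
    rewrite ler_piMr// mulr_ile1 ?divr_ge0// ?(ltW w1)//.
      by rewrite ler_pdivrMr// mul1r ler_nat ltnS ltnW.
    by rewrite ler_pdivrMr// mul1r lerDl.
  have -> : u + (j.+1%:R * d) *: w + d *: w = u + (j.+2%:R * d) *: w.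
    by rewrite -addrA -scalerDl -[j.+2%:R]natr1 mulrDl mul1r.
  have -> : u + (j.+1%:R * d) *: w - d *: w = u + (j%:R * d) *: w.
    by rewrite -addrA -scalerBl -[j.+1%:R]natr1 mulrDl mul1r addrK.
  exact: ltW.
move=> /(_ gc); have := gS N; have := gS 0%N; rewrite !ler_norml.
move=> /andP[h1 h2] /andP[h3 h4] h.
have : N%:R * eta * d <= 2 * `|w| * d by lra.
by rewrite ler_pM2r// leNgt Nw.
Qed.

(* Far out in a narrow cone around u' the increments |z + w| - |z| are almost
   constant: this replaces differentiability of the norm at u'. *)
Definition flat_cone {R : realType} {X : normedModType R} (u' : X) (rho K : R)
    (e : R) (w : X) :=
  forall k k' z z', K <= k -> K <= k' ->
    `|z - k *: u'| <= rho * k -> `|z' - k' *: u'| <= rho * k' ->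
    `|z + w| - `|z| - (`|z' + w| - `|z'|) <= e.

(** Induction on [F]: the axis is moved slightly along the new [w] to a point of small second
    difference, and the cone is narrowed so as to stay inside the old one, which keeps the earlier
    directions flat. *)
Lemma flat_cone_exists (R : realType) (X : normedModType R) (F : seq X) (u : X)
    (e : R) : 0 < e -> exists u' rho K,
  [/\ `|u' - u| < e, 0 < rho, 0 < K &
      forall w, w \in F -> flat_cone u' rho K e w].
Proof.
move=> e0; elim: F => [|w F [u' [rho [K [u'u rho0 K0 FF]]]]].
  by exists u, 1, 1; split => //; rewrite subrr normr0.
pose r := Num.min (rho / 2) ((e - `|u' - u|) / 2).
have r0 : 0 < r by rewrite lt_min; apply/andP; split; lra.
have e4 : 0 < e / 2 by lra.
have [t [d [d0 tr dd]]] := @small_second_difference _ X u' w _ _ e4 r0.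
move: tr; rewrite le_min => /andP[tr1 tr2].
set u'' := u' + t *: w.
(* Replacing the normalised point by [u''] costs [e * d / 8] twice; [k >= d^-1] lets the increment
   along [w] be compared with the difference quotient of step [d]. *)
pose rho' := Num.min (rho / 2) (e * d / 8).
pose K' := Num.max K d^-1.
have rho'0 : 0 < rho' by rewrite lt_min; apply/andP; split; rewrite ?divr_gt0// mulr_gt0.
exists u'', rho', K'; split => //.
- have : `|u'' - u| <= `|u' - u| + `|t *: w| by rewrite addrAC ler_normD.
  lra.
- by rewrite lt_max K0.
have shrink k z : K' <= k -> `|z - k *: u''| <= rho' * k ->
    [/\ K <= k, 0 < k, d^-1 <= k, `|z - k *: u'| <= rho * k &
      `|z - k *: u''| <= e * d / 8 * k].
  rewrite ge_max => /andP[Kk dk]; have k0 := lt_le_trans K0 Kk.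
  rewrite /rho' => h; split => //.
    have : `|z - k *: u'| <= `|z - k *: u''| + `|k *: (t *: w)|.
      rewrite -[in leLHS](subrK (k *: u'') z) -addrA.
      rewrite [X in _ + X](_ : _ = k *: (t *: w)) ?ler_normD//.
      by rewrite -scalerBr addrAC subrr add0r.
    move=> /le_trans; apply.
    have -> : rho * k = rho / 2 * k + k * (rho / 2) by lra.
    apply: lerD; first by rewrite (le_trans h)// ler_wpM2r ?(ltW k0)// ge_min lexx.
    by rewrite normrZ (gtr0_norm k0) ler_wpM2l// ltW.
  by rewrite (le_trans h)// ler_wpM2r ?(ltW k0)// ge_min lexx orbT.
move=> w'; rewrite inE => /orP[/eqP->|w'F]; last first.
  move=> k k' z z' /shrink hk /shrink hk' /hk[? ? ? ? ?] /hk'[? ? ? ? ?].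
  exact: (FF _ w'F k k').
move=> k k' z z' /shrink hk /shrink hk' /hk[_ k0 dk _ zk] /hk'[_ k'0 dk' _ zk'].
have dinv : 0 < d^-1 by rewrite invr_gt0.
(* |kp + w| - |kp| decreases in k, by the triangle inequality *)
have up k1 z1 w1 : 0 < k1 -> d^-1 <= k1 -> `|z1 - k1 *: u''| <= e * d / 8 * k1 ->
    `|z1 + w1| - `|z1| <= (`|u'' + d *: w1| - `|u''|) / d + e / 4.
  move=> k10 dk1 h; pose p := k1^-1 *: z1.
  have zp : z1 = k1 *: p by rewrite scalerA mulfV ?scale1r// gt_eqF.
  have pu : `|p - u''| <= e * d / 8.
    rewrite -(ler_pM2l k10) mulrC -[in leLHS](gtr0_norm k10) mulrC -normrZ scalerBr.
    by rewrite -zp mulrC.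
  have h1 : `|z1 + w1| <= `|d^-1 *: (p + d *: w1)| + (k1 - d^-1) * `|p|.
    have -> : z1 + w1 = d^-1 *: (p + d *: w1) + (k1 - d^-1) *: p.
      rewrite scalerDr [d^-1 *: (d *: _)]scalerA mulVf ?gt_eqF// scale1r addrAC -scalerDl zp.
      by rewrite [d^-1 + _]addrC subrK.
    by rewrite (le_trans (ler_normD _ _))// lerD2l normrZ ger0_norm// subr_ge0.
  have h2 : `|z1| = k1 * `|p| by rewrite zp normrZ gtr0_norm.
  have h3 : `|p + d *: w1| <= `|u'' + d *: w1| + e * d / 8.
    rewrite (_ : p + _ = u'' + d *: w1 + (p - u'')); last by rewrite [RHS]addrAC [u'' + (_ - _)]addrC subrK.
    by rewrite (le_trans (ler_normD _ _))// lerD2l.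
  have h4 : `|u''| - `|p| <= e * d / 8.
    by rewrite (le_trans (lerB_dist _ _))// distrC.
  move: h1; rewrite normrZ (gtr0_norm dinv) h2 => h1.
  have h5 : `|z1 + w1| - k1 * `|p| <= d^-1 * (`|p + d *: w1| - `|p|) by lra.
  apply: (le_trans h5).
  have -> : (`|u'' + d *: w1| - `|u''|) / d + e / 4 =
    d^-1 * (`|u'' + d *: w1| - `|u''| + e * d / 4).
    by field; rewrite gt_eqF.
  rewrite ler_pM2l//; lra.
have A := up _ _ w k0 dk zk.
have B := up _ _ (- w) k'0 dk' zk'.
(* Convexity turns the upper bound along [- w] at [z'] into a lower bound along [w]. Up to [e / 2],
   the gap between the bounds is the second difference divided by [d]. *)
have C : `|z'| - `|z' + w| <= `|z' - w| - `|z'|.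
  have : `|z' + z'| <= `|z' + w| + `|z' - w|.
    by rewrite (le_trans _ (ler_normD _ _))// addrACA subrr addr0.
  by rewrite -mulr2n normrMn -mulr_natl; lra.
have D : (`|u'' + d *: w| - `|u''|) / d + (`|u'' + d *: - w| - `|u''|) / d <= e / 2.
  rewrite -mulrDl ler_pdivrMr// scalerN; lra.
lra.
Qed.

(** * Coarse isometries and an approximate Mazur-Ulam theorem *)

Definition coarse_isometry {R : realType} {X : normedModType R} (e : R)
    (g g' : X -> X) :=
  [/\ forall x y, `| `|g x - g y| - `|x - y| | <= e,
      forall x y, `| `|g' x - g' y| - `|x - y| | <= e,
      forall x, `|g (g' x) - x| <= e &
      forall x, `|g' (g x) - x| <= e].

(** The first map is [g], a point reflection, [g'] and another point reflection; the second undoes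
    it. Distances lose [2 * e], the inverse relations [3 * e]. *)
Lemma coarse_isometry_reflections (R : realType) (X : normedModType R) (e : R)
    (g g' : X -> X) (c c' : X) : coarse_isometry e g g' ->
  coarse_isometry (3 * e) (fun x => c - g' (c' - g x))
                          (fun x => g' (c' - g (c - x))).
Proof.
move=> [ig ig' gg' g'g].
have refl (b x y : X) : `|(b - x) - (b - y)| = `|x - y|.
  by rewrite opprB addrC addrA subrK distrC.
have e0 : 0 <= e by apply: le_trans (normr_ge0 _) (ig 0 0).
split => [x y|x y|x|x].
- rewrite refl; have := ig' (c' - g x) (c' - g y); rewrite refl.
  by have := ig x y; rewrite !ler_norml => /andP[? ?] /andP[? ?]; apply/andP; split; lra.
- have := ig' (c' - g (c - x)) (c' - g (c - y)); rewrite refl.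
  have := ig (c - x) (c - y); rewrite refl.
  by rewrite !ler_norml => /andP[? ?] /andP[? ?]; apply/andP; split; lra.
- have -> : c - g' (c' - g (g' (c' - g (c - x)))) - x =
            (c - x) - g' (c' - g (g' (c' - g (c - x)))) by rewrite addrAC.
  set y := c' - g (c - x).
  have := ler_distD (g' (g (c - x))) (c - x) (g' (c' - g (g' y))).
  have := g'g (c - x); rewrite (distrC _ (c - x)).
  have := ig' (g (c - x)) (c' - g (g' y)); rewrite ler_norml => /andP[_].
  have -> : g (c - x) - (c' - g (g' y)) = (g (g' y) - y).
    by rewrite /y !opprB addrC addrA addrAC.
  have := gg' y; lra.
- set y := c' - g x.
  have -> : c - (c - g' y) = g' y by rewrite opprB addrC subrK.
  have := ler_distD (g' (g x)) (g' (c' - g (g' y))) x.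
  have := g'g x.
  have := ig' (c' - g (g' y)) (g x); rewrite ler_norml => /andP[_].
  have -> : c' - g (g' y) - g x = y - g (g' y) by rewrite /y addrAC.
  by rewrite [`|y - _|]distrC; have := gg' y; lra.
Qed.

(* Vaisala's proof of the Mazur-Ulam theorem with error terms: passing from g to
   psi o g^-1 o psi o g, psi the reflection in z, doubles the displacement of z
   and triples the error. *)
Lemma coarse_isometry_center (R : realType) (X : normedModType R) (z v : X) n :
  forall (e : R) (g g' : X -> X), coarse_isometry e g g' ->
    `|g (z + v) - (z + v)| <= 3 * e -> `|g (z - v) - (z - v)| <= 3 * e ->
    `|g z - z| <= 2 * `|v| / 2 ^+ n + (6 * (3 / 2) ^+ n - 2) * e.
Proof.
(* The coefficient of [e] solves [c (n + 1) = (3 * c n + 2) / 2] with [c 0 = 4]. *)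
elim: n => [|n IH] e g g' gg ga gb.
  rewrite !expr0 divr1; case: gg => ig _ _ _.
  have := ig z (z + v); rewrite opprD addrA subrr add0r normrN ler_norml => /andP[_ h].
  have := ler_distD (z + v) (g z) z.
  have := ler_distD (g (z + v)) (g z) (z + v).
  by rewrite [z + v - z]addrAC subrr add0r; lra.
have hh := coarse_isometry_reflections _ _ _ _ _ (z + z) (z + z) gg.
have refl (b x y : X) : `|(b - x) - (b - y)| = `|x - y|.
  by rewrite opprB addrC addrA subrK distrC.
case: gg => ig ig' gg' g'g.
have e0 : 0 <= e by apply: le_trans (normr_ge0 _) (ig 0 0).
have psiD : z + z - (z + v) = z - v by rewrite opprD addrACA subrr add0r.
have psiB : z + z - (z - v) = z + v by rewrite opprB addrC addrA subrK addrC.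
have swap a b : a = z + z - b -> `|g a - a| <= 3 * e -> `|g b - b| <= 3 * e ->
    `|z + z - g' (z + z - g a) - a| <= 3 * (3 * e).
  move=> ab ha hb.
  have -> : z + z - g' (z + z - g a) - a = b - g' (z + z - g a).
    by rewrite ab opprB addrC addrA subrK.
  have := ler_distD (g' (g b)) b (g' (z + z - g a)).
  have := g'g b; rewrite (distrC _ b).
  have := ig' (g b) (z + z - g a); rewrite ler_norml => /andP[_].
  have := ler_distD b (g b) (z + z - g a).
  have -> : b - (z + z - g a) = g a - a.
    by rewrite ab opprB addrCA opprB.
  by move: ha hb; lra.
have := IH _ _ _ hh (swap _ _ (esym psiB) ga gb) (swap _ _ (esym psiD) gb ga).
have -> : z + z - g' (z + z - g z) - z = z - g' (z + z - g z).
  by rewrite addrAC addrK.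
have := ler_distD (g' (z + z - g z)) (g' (g z)) z.
have := ler_distD z (g' (g z)) (g' (z + z - g z)).
have := g'g z.
have := ig' (g z) (z + z - g z); rewrite ler_norml => /andP[+ _].
have -> : g z - (z + z - g z) = (g z - z) *+ 2.
  by rewrite mulr2n opprB addrA opprD addrACA.
rewrite normrMn.
have -> : (3 / 2 : R) ^+ n.+1 = 3 / 2 * (3 / 2) ^+ n by rewrite exprS.
have -> : 2 * `|v| / 2 ^+ n.+1 = 2 * `|v| / 2 ^+ n / 2.
  by rewrite exprSr invfM mulrA.
lra.
Qed.

(** The map [x |-> z + z - g' (c - g x)], with [c] the sum of the images of [z + v] and [z - v],
    nearly fixes these two points and moves [z] by about twice the distance to be bounded. *)
Lemma coarse_isometry_midpoint (R : realType) (X : normedModType R) (z v : X)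
    (e : R) (g g' : X -> X) n : coarse_isometry e g g' ->
  `|g z - 2^-1 *: (g (z + v) + g (z - v))|
    <= `|v| / 2 ^+ n + 10 * (3 / 2) ^+ n * e.
Proof.
move=> gg.
set c := g (z + v) + g (z - v).
have hh := coarse_isometry_reflections _ _ _ _ _ (z + z) c gg.
case: gg => ig ig' gg' g'g.
have e0 : 0 <= e by apply: le_trans (normr_ge0 _) (ig 0 0).
have ha : `|z + z - g' (c - g (z + v)) - (z + v)| <= 3 * (3 * e).
  have -> : z + z - g' (c - g (z + v)) - (z + v) = z - v - g' (g (z - v)).
    by rewrite /c [g (z + v) + _]addrC addrK addrAC opprD addrACA subrr add0r.
  by rewrite distrC; have := g'g (z - v); lra.
have hb : `|z + z - g' (c - g (z - v)) - (z - v)| <= 3 * (3 * e).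
  have -> : z + z - g' (c - g (z - v)) - (z - v) = z + v - g' (g (z + v)).
    rewrite /c addrK addrAC; congr (_ - _).
    by rewrite opprB addrC addrA subrK addrC.
  by rewrite distrC; have := g'g (z + v); lra.
have := @coarse_isometry_center _ _ z v n _ _ _ hh ha hb.
have -> : z + z - g' (c - g z) - z = z - g' (c - g z).
  by rewrite addrAC addrK.
have := ler_distD z (g' (g z)) (g' (c - g z)).
have := g'g z.
have := ig' (g z) (c - g z); rewrite ler_norml => /andP[+ _].
have -> : g z - (c - g z) = (g z - 2^-1 *: c) *+ 2.
  rewrite -scaler_nat scalerBr scalerA mulfV// scale1r scaler_nat mulr2n.
  by rewrite opprB addrA.
rewrite normrMn.
have : 1 <= (3 / 2 : R) ^+ n by apply: exprn_ege1; lra.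
move=> /(ler_wpM2r e0); lra.
Qed.


Lemma geometric_cvg (R : realType) (X : completeNormedModType R) (u : nat -> X)
    (C : R) : (forall m, `|u m - u m.+1| <= C * (3 / 4) ^+ m) ->
  exists l : X, u @ \oo --> l.
Proof.
move=> uC.
have C0 : 0 <= C by have := uC 0%N; rewrite expr0 mulr1; apply: le_trans.
have cv : cvgn (series (telescope u)).
  apply: normed_cvg.
  apply: (@series_le_cvg _ _ (geometric C (3 / 4))) => [n|n|n|].
  - exact: normr_ge0.
  - by rewrite /geometric /= mulr_ge0// exprn_ge0//; lra.
  - by rewrite /telescope /= distrC.
  - by apply: is_cvg_geometric_series; rewrite ger0_norm; lra.
exists (u 0%N + lim (series (telescope u) @ \oo)).
have ue : (fun n => u 0%N + series (telescope u) n) = u.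
  by apply/funext => n; rewrite -eq_sum_telescope.
have : (fun n => u 0%N + series (telescope u) n) @ \oo -->
    u 0%N + lim (series (telescope u) @ \oo).
  by apply: cvgD => //; exact: cvg_cst.
by rewrite ue.
Qed.

Lemma geometric_cvg_dist (R : realType) (X : normedModType R) (u : nat -> X)
    (l : X) (C : R) : (forall m, `|u m - u m.+1| <= C * (3 / 4) ^+ m) ->
  u @ \oo --> l -> `|u 0%N - l| <= 4 * C.
Proof.
move=> uC ul.
have C0 : 0 <= C by have := uC 0%N; rewrite expr0 mulr1; apply: le_trans.
have bd m : `|u 0%N - u m| <= 4 * C - 4 * C * (3 / 4) ^+ m.
  elim: m => [|m IH]; first by rewrite subrr normr0 expr0 mulr1 subrr.
  have := ler_distD (u m) (u 0%N) (u m.+1); have := uC m; rewrite exprS; lra.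
have : (fun m => `|u 0%N - u m|) @ \oo --> `|u 0%N - l|.
  by apply: cvg_norm; apply: cvgB => //; exact: cvg_cst.
move/cvgr_to_le; apply; near=> m.
rewrite (le_trans (bd m))// gerBl mulr_ge0 ?exprn_ge0//; lra.
Unshelve. all: by end_near. Qed.

Lemma coarse_isometry_near_isometry (R : realType) (X : completeNormedModType R)
    (e : R) (g g' : X -> X) : coarse_isometry e g g' ->
  exists V : X -> X, (forall x y, `|V x - V y| = `|x - y|) /\
    forall eta, 0 < eta -> exists C, forall x, `|g x - V x| <= eta * `|x| + C.
Proof.
move=> gg.
have e0 : 0 <= e by case: gg => ig _ _ _; apply: le_trans (normr_ge0 _) (ig 0 0).
pose A x m := (2 ^+ m)^-1 *: g (2 ^+ m *: x).
have pow2 m : 0 < (2 ^+ m : R) by rewrite exprn_gt0.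
(* The free [p] makes the coefficient of [|x|] small at the price of a larger constant. The ratio
   [3 / 4] is the midpoint error [(3 / 2) ^+ m] over the scale [2 ^+ m]. *)
have Abound p x m : `|A x m - A x m.+1| <=
    (`|x| / 2 ^+ p + 10 * (3 / 2) ^+ p * e + `|g 0|) * (3 / 4) ^+ m.
  have := @coarse_isometry_midpoint _ _ (2 ^+ m *: x) (2 ^+ m *: x) _ _ _ (m + p) gg.
  rewrite subrr -scalerDl.
  have -> : 2 ^+ m + 2 ^+ m = 2 ^+ m.+1 :> R by rewrite exprS; lra.
  rewrite normrZ (gtr0_norm (pow2 m)) => h.
  have -> : A x m - A x m.+1 = (2 ^+ m)^-1 *:
      (g (2 ^+ m *: x) - 2^-1 *: (g (2 ^+ m.+1 *: x) + g 0) + 2^-1 *: g 0).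
    rewrite /A exprS invfM [2^-1 * _]mulrC -scalerA -scalerBr; congr (_ *: _).
    by rewrite scalerDr opprD addrA subrK.
  rewrite normrZ gtr0_norm ?invr_gt0// ler_pdivrMl//.
  apply: (le_trans (ler_normD _ _)); rewrite normrZ gtr0_norm ?invr_gt0//.
  apply: (le_trans (lerD h (lexx _))).
  have q1 : 1 <= (3 / 2 : R) ^+ m by apply: exprn_ege1; lra.
  have -> : 2 ^+ m * ((`|x| / 2 ^+ p + 10 * (3 / 2) ^+ p * e + `|g 0|) * (3 / 4) ^+ m) =
     (`|x| / 2 ^+ p + 10 * (3 / 2) ^+ p * e + `|g 0|) * (3 / 2) ^+ m.
    rewrite mulrCA -exprMn; congr (_ * _ ^+ _); lra.
  have -> : 2 ^+ m * `|x| / 2 ^+ (m + p) = `|x| / 2 ^+ p.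
    by rewrite exprD; field; rewrite !gt_eqF.
  have -> : (3 / 2 : R) ^+ (m + p) = (3 / 2) ^+ m * (3 / 2) ^+ p by rewrite exprD.
  have x0 : 0 <= `|x| / 2 ^+ p by rewrite divr_ge0// ltW.
  have := ler_wpM2r x0 q1; have := ler_wpM2r (normr_ge0 (g 0)) q1.
  have := normr_ge0 (g 0); lra.
have /choice[V VA] : forall x, exists l : X, A x @ \oo --> l.
  by move=> x; apply: geometric_cvg => m; exact: (Abound 0%N).
exists V; split => [x y|eta eta0]; last first.
  have [p p4] : exists p, 4 / 2 ^+ p <= eta.
    exists (Num.bound (4 / eta)).
    rewrite ler_pdivrMr// -ler_pdivrMl// mulrC.
    apply: (@le_trans _ _ (Num.bound (4 / eta))%:R); last first.
      by rewrite -natrX ler_nat ltnW// ltn_expl.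
    by apply/ltW/archi_boundP; rewrite divr_ge0// ltW.
  exists (4 * (10 * (3 / 2) ^+ p * e + `|g 0|)) => x.
  have := geometric_cvg_dist _ _ _ _ _ (Abound p x) (VA x).
  rewrite /A expr0 invr1 !scale1r => /le_trans; apply.
  have := ler_wpM2r (normr_ge0 x) p4.
  by rewrite mulrAC; lra.
have cvd : (fun m => `|A x m - A y m|) @ \oo --> `|V x - V y|.
  by apply: cvg_norm; apply: cvgB.
have Am m : `| `|A x m - A y m| - `|x - y| | <= e * 2^-1 ^+ m.
  rewrite /A -scalerBr normrZ gtr0_norm ?invr_gt0//.
  case: gg => /(_ (2 ^+ m *: x) (2 ^+ m *: y)) + _ _ _.
  rewrite -scalerBr normrZ gtr0_norm// => h.
  have -> : `|x - y| = (2 ^+ m)^-1 * (2 ^+ m * `|x - y|) by rewrite mulrA mulVf ?mul1r ?gt_eqF.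
  rewrite -mulrBr normrM gtr0_norm ?invr_gt0//.
  rewrite mulrC exprVn. by rewrite ler_wpM2r.
have cv0 : (fun m => e * 2^-1 ^+ m) @ \oo --> (0 : R).
  rewrite -(mulr0 e); apply: cvgMr; apply: cvg_expr; rewrite ger0_norm; lra.
apply/eqP; rewrite -subr_eq0 -normr_eq0 eq_le normr_ge0 andbT.
have cvd' : (fun m => `| `|A x m - A y m| - `|x - y| |%R) @ \oo --> `| `|V x - V y| - `|x - y| |%R.
  by apply: cvg_norm; apply: cvgB => //; exact: cvg_cst.
by apply: (ler_cvg_to cvd' cv0); near=> m; exact: Am.
Unshelve. all: by end_near. Qed.

(** * Density, limits along ultrafilters and weak limits *)

Lemma dense_approx (R : realType) (X : normedModType R) (S : set X) (x : X)
    (e : R) : dense S -> 0 < e -> exists2 s, S s & `|s - x| < e.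
Proof.
move=> Sd e0; have [] := Sd (ball x e) _ (ball_open x e).
  by exists x; exact: ballxx.
by move=> s [xs Ss]; exists s => //; rewrite distrC; move: xs; rewrite -ball_normE.
Qed.

(* ler_cvg_to without its topology on the index type *)
Lemma filter_ler_cvg (R : realType) (I : Type) (F : set_system I)
    (FF : ProperFilter F) (f g : I -> R) (l l' : R) :
  f @ F --> l -> g @ F --> l' -> (\forall i \near F, f i <= g i) -> l <= l'.
Proof.
move=> fl gl fg; rewrite -subr_le0.
have fgl : (fun i => f i - g i) @ F --> l - l' by apply: cvgB.
by apply: (cvgr_to_le fgl); apply: filterS fg => i; rewrite subr_le0.
Qed.

Lemma bounded_ultra_cvg (R : realType) (I : Type) (U : set_system I)
    (UU : UltraFilter U) (g : I -> R) (M : R) :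
  (forall i, `|g i| <= M) -> exists l : R, g @ U --> l.
Proof.
move=> gM.
have gU : U (g @^-1` `[- M, M]%classic).
  by apply: filterE => i; rewrite /= in_itv /=; move: (gM i); rewrite ler_norml.
have [l [_ gl]] := @segment_compact R (- M) M (g @ U) _ gU.
exists l => B lB; have [//|UB] := in_ultra_setVsetC (g @^-1` B) UU.
by have [y [/= nBy By]] := gl (~` B) B UB lB.
Qed.

Lemma dual_linearZ (R : realType) (X : normedModType R) (f : dual X) (a : R) x :
  f (a *: x) = a * f x.
Proof. by rewrite linearZ. Qed.

Lemma dual_of_bounded (R : realType) (X : normedModType R) (f : X -> R^o)
    (C : R) : linear f -> (forall x, `|f x| <= C * `|x|) ->
  exists g : dual X, forall x, g x = f x.
Proof.
move=> fl fC.
pose ev : {linear X -> R^o} := HB.pack f (GRing.isLinear.Build _ _ _ _ _ fl).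
have fP : f \in continuous_functional X.
  rewrite inE /=; split=> //.
  apply/(linear_bounded_continuous ev)/bounded_funP => r.
  exists (`|C| * r) => x xr; rewrite (le_trans (fC x))//.
  by rewrite (le_trans (ler_wpM2r _ (ler_norm C)))// ler_wpM2l.
by exists (Dual fP).
Qed.

(** The limits of [f (b i)], as [f] varies, form a bounded functional on the dual, which reflexivity
    represents by a point. *)
Lemma weak_ultra_limit (R : realType) (X : normedModType R) (I : Type)
    (U : set_system I) (UU : UltraFilter U) (b : I -> X) (M : R) :
  reflexive_space X -> (forall i, `|b i| <= M) ->
  exists D : X, forall f : dual X, (fun i => f (b i)) @ U --> f D.
Proof.
move=> Xr bM.
have fb (f : dual X) i : `|f (b i)| <= M * `|f|.
  by rewrite (le_trans (dual_norm_le f _))// mulrC ler_wpM2r// dual_norm_ge0.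
have /choice[P PU] : forall f : dual X, exists l : R, (fun i => f (b i)) @ U --> l.
  by move=> f; apply: bounded_ultra_cvg (fb f).
have Pl : linear (P : dual X -> R^o).
  move=> a f g; apply/esym; apply: norm_cvg_unique (PU _).
  by apply: cvgD (PU g); apply: cvgMr (PU f).
have PM f : `|P f| <= M * `|f|.
  have nP : (fun i => `|f (b i)|) @ U --> `|P f| by apply: cvg_norm (PU f).
  by apply: cvgr_to_le nP _; apply: filterE => i; exact: fb.
have [Phi PhiE] := dual_of_bounded _ _ _ _ Pl PM.
have [D DPhi] := Xr Phi; exists D => f.
by rewrite (_ : f D = P f)// -PhiE -DPhi.
Qed.

(** * Norming functionals monotone along [T] *)

(** Unlike [step_isometry], this does not ask that [T] map [S] into itself; it is applied to
    [V \o T], which may leave [S]. *)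
Definition step_preserving {R : realType} {X : normedModType R} (S : set X)
    (T : X -> X) :=
  forall x y (N : int), S x -> S y ->
    (`|x - y| < N%:~R) = (`|T x - T y| < N%:~R).

Definition asymptotic_to_id {R : realType} {X : normedModType R} (S : set X)
    (T : X -> X) :=
  forall eta, 0 < eta -> exists C, forall x, S x -> `|T x - x| <= eta * `|x| + C.

Definition step_monotone {R : realType} {X : normedModType R} (S : set X)
    (T : X -> X) (f : X -> R) :=
  forall x y (n : int), S x -> S y -> f x + n%:~R < f y ->
    f (T x) + n%:~R <= f (T y).

(* The far away points of S in the direction -u' compare the increments at x
   and y, through the integer thresholds. *)
Lemma flat_cone_step (R : realType) (X : normedModType R) (S : set X)
    (T : X -> X) (u' : X) (rho K e : R) (x y : X) (n : int) :
  dense S -> step_preserving S T -> asymptotic_to_id S T ->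
  u' != 0 -> 0 < rho -> 0 < K -> 0 < e -> S x -> S y ->
  {in [:: x; y; T x; T y], forall w, flat_cone u' rho K e w} ->
  let c w := `|K *: u' + w| - `|K *: u'| in
  c x + n%:~R + 4 * e < c y -> c (T x) + n%:~R <= c (T y) + 2 * e.
Proof.
move=> Sd sT aT u'0 rho0 K0 e0 Sx Sy flat c cxy.
have nu0 : 0 < `|u'| by rewrite normr_gt0.
pose eta := rho / 2 / `|u'|.
have eta0 : 0 < eta by rewrite !divr_gt0.
have [C TC] := aT eta eta0.
(* From [t0] on, the displacement of [z], which is o(|z|), fits into the cone, so that [- T z] lies
   in it along with [- z]. *)
pose t0 := Num.max K ((`|C| + e + eta * e) / (rho / 2)).
pose N : int := Num.bound (`|t0 * `|u'| + c x + 2 * e|).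
have NP : t0 * `|u'| + c x + 2 * e <= N%:~R.
  by rewrite (le_trans (ler_norm _))//; apply/ltW/archi_boundP.
(* With [t * |u'| + c x + 2 * e] equal to the integer [N], the point [x] falls just inside distance
   [N] of [z], while the margin [4 * e] keeps [y] outside distance [N + n]. *)
pose t := (N%:~R - c x - 2 * e) / `|u'|.
have tu : t * `|u'| = N%:~R - c x - 2 * e by rewrite mulfVK// gt_eqF.
have : t0 <= t by rewrite ler_pdivlMr//; lra.
rewrite ge_max => /andP[Kt].
have rho2 : 0 < rho / 2 by lra.
rewrite ler_pdivrMr// => Ct.
have t0' : 0 < t := lt_le_trans K0 Kt.
have [z Sz zt] : exists2 z, S z & `|z - (- (t *: u'))| < Num.min (e / 2) (rho * t).
  by apply: dense_approx => //; rewrite lt_min; apply/andP; split; [lra|exact: mulr_gt0].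
move: zt; rewrite opprK lt_min => /andP[zt1 zt2].
have nz1 : `|z| <= t * `|u'| + e / 2.
  have := ler_normB (z + t *: u') (t *: u'); rewrite addrK normrZ gtr0_norm//; lra.
have tz : `|- T z - t *: u'| <= rho * t.
  have -> : - T z - t *: u' = - ((T z - z) + (z + t *: u')).
    by rewrite addrA subrK opprD.
  rewrite normrN (le_trans (ler_normD _ _))//; have := TC z Sz.
  have : eta * `|z| <= eta * (t * `|u'| + e / 2) by rewrite ler_pM2l.
  have -> : eta * (t * `|u'| + e / 2) = rho / 2 * t + eta * e / 2.
    by rewrite /eta; field; rewrite gt_eqF.
  have := ler_norm C; have := mulr_gt0 eta0 e0; lra.
have cone1 w : w \in [:: x; y; T x; T y] ->
    `| `|w - z| - `|z| - c w| <= e /\ `| `|w - T z| - `|T z| - c w| <= e.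
  move=> /flat fw.
  have K1 : `|K *: u' - K *: u'| <= rho * K by rewrite subrr normr0 ltW// mulr_gt0.
  have z1 : `|- z - t *: u'| <= rho * t by rewrite -opprD normrN ltW.
  have := fw _ _ _ _ (lexx K) Kt K1 z1; have := fw _ _ _ _ Kt (lexx K) z1 K1.
  have := fw _ _ _ _ (lexx K) Kt K1 tz; have := fw _ _ _ _ Kt (lexx K) tz K1.
  rewrite !normrN ![- _ + w]addrC /c !ler_norml => ? ? ? ?.
  by split; apply/andP; split; lra.
have nz2 : `|z| <= N%:~R - c x - 2 * e + e / 2 by rewrite -tu.
have nz3 : N%:~R - c x - 2 * e - e / 2 <= `|z|.
  rewrite -tu.
  by have := ler_normB (z + t *: u') z; rewrite addrAC subrr add0r normrZ gtr0_norm//; lra.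
have [] := cone1 x; rewrite ?inE ?eqxx// !ler_norml => /andP[_ hx] _.
have [] := cone1 y; rewrite ?inE ?eqxx ?orbT// !ler_norml => /andP[hy _] _.
have [] := cone1 (T x); rewrite ?inE ?eqxx ?orbT// !ler_norml => _ /andP[hTx _].
have [] := cone1 (T y); rewrite ?inE ?eqxx ?orbT// !ler_norml => _ /andP[_ hTy].
have xz : `|x - z| < N%:~R by lra.
have yz : (`|y - z| < (N + n)%:~R) = false.
  by apply/negbTE; rewrite -leNgt intrD; lra.
rewrite sT// in xz; rewrite sT// in yz.
move/negbT: yz; rewrite -leNgt intrD; lra.
Qed.

(* A finite approximation, up to e and on F only, of a linear functional that
   norms u and is step-monotone. *)
Definition approx_step_functional {R : realType} {X : normedModType R}
    (S : set X) (T : X -> X) (u : X) (F : seq X) (e : R) (c : X -> R) :=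
  [/\ forall w, `|c w| <= `|w|,
      `|u| - 2 * e <= c u,
      forall v w, v \in F -> w \in F -> v + w \in F ->
        `|c (v + w) - (c v + c w)| <= 3 * e,
      forall (t : R) w, 0 < t -> w \in F -> t *: w \in F ->
        `|c (t *: w) - t * c w| <= (1 + t) * e &
      forall x y (n : int), S x -> S y ->
        {subset [:: x; y; T x; T y] <= F} ->
        c x + n%:~R + 4 * e < c y -> c (T x) + n%:~R <= c (T y) + 2 * e].

(** Take for [c] the increments of the norm at [K *: u'], far out in a flat cone. Flatness lets the
    base point move within the cone, whence additivity and homogeneity up to multiples of [e]. *)
Lemma approx_step_functional_exists (R : realType) (X : normedModType R)
    (S : set X) (T : X -> X) (u : X) (F : seq X) (e : R) :
  dense S -> step_preserving S T -> asymptotic_to_id S T -> 0 < e -> e < `|u| ->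
  exists c, approx_step_functional S T u F e c.
Proof.
move=> Sd sT aT e0 eu.
have [u' [rho [K [u'u rho0 K0 flat]]]] := @flat_cone_exists _ _ F u e e0.
have nu'u : `|u| - `|u'| < e by rewrite (le_lt_trans (lerB_dist _ _))// distrC.
have nu' : 0 < `|u'| by lra.
have u'0 : u' != 0 by rewrite -normr_gt0.
have cone1 w k z : w \in F -> K <= k -> `|z - k *: u'| <= rho * k ->
    `| `|z + w| - `|z| - (`|K *: u' + w| - `|K *: u'|)| <= e.
  move=> wF Kk zk.
  have K1 : `|K *: u' - K *: u'| <= rho * K by rewrite subrr normr0 ltW// mulr_gt0.
  have := flat _ wF _ _ _ _ (lexx K) Kk K1 zk.
  have := flat _ wF _ _ _ _ Kk (lexx K) zk K1.
  by rewrite ler_norml => ? ?; apply/andP; split; lra.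
exists (fun w => `|K *: u' + w| - `|K *: u'|); split => [w||v w vF wF vwF|t w t0 wF twF|].
- by rewrite (le_trans (ler_dist_dist _ _))// addrAC subrr add0r.
- have := ler_normB (K *: u' + u) (u - u').
  rewrite opprB -addrA [u + (_ - _)]addrC subrK -[X in _ + X]scale1r -scalerDl !normrZ.
  rewrite !gtr0_norm ?addr_gt0// distrC; lra.
(* Such a [k] keeps [k *: u' + v] in the cone, so the increment along [w] may be taken after the one
   along [v]. *)
- pose k := Num.max K (`|v| / rho).
  have Kk : K <= k by rewrite le_max lexx.
  have k0 : 0 < k := lt_le_trans K0 Kk.
  have vk : `|v| <= rho * k by rewrite -ler_pdivrMl// mulrC le_max lexx orbT.
  have k1 : `|k *: u' - k *: u'| <= rho * k by rewrite subrr normr0 ltW// mulr_gt0.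
  have k2 : `|(k *: u' + v) - k *: u'| <= rho * k by rewrite addrAC subrr add0r.
  have := cone1 _ _ _ vwF Kk k1; have := cone1 _ _ _ vF Kk k1; have := cone1 _ _ _ wF Kk k2.
  rewrite (addrA (k *: u')) !ler_norml => /andP[? ?] /andP[? ?] /andP[? ?].
  by apply/andP; split; lra.
- pose k := Num.max K (t^-1 * K).
  have Kk : K <= k by rewrite le_max lexx.
  have k0 : 0 < k := lt_le_trans K0 Kk.
  have Ktk : K <= t * k by rewrite -ler_pdivrMl// le_max lexx orbT.
  have k1 : `|k *: u' - k *: u'| <= rho * k by rewrite subrr normr0 ltW// mulr_gt0.
  have k2 : `|(t * k) *: u' - (t * k) *: u'| <= rho * (t * k).
    by rewrite subrr normr0 ltW// mulr_gt0// mulr_gt0.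
  have := cone1 _ _ _ twF Ktk k2; have := cone1 _ _ _ wF Kk k1.
  rewrite -scalerA -scalerDr !(normrZ t) (gtr0_norm t0) -mulrBr => h.
  have : t * `| `|k *: u' + w| - `|k *: u'| - (`|K *: u' + w| - `|K *: u'|)| <= t * e.
    by rewrite ler_pM2l.
  rewrite -[X in X * `|_|](gtr0_norm t0) -normrM mulrBr !ler_norml => /andP[? ?] /andP[? ?].
  by apply/andP; split; lra.
- move=> x y n Sx Sy sF; apply: (@flat_cone_step _ _ S T u' rho K e) => //.
  by move=> w wF; apply: flat; exact: sF.
Qed.

Lemma step_functional_exists (R : realType) (X : normedModType R)
    (S : set X) (T : X -> X) (u : X) :
  dense S -> step_preserving S T -> asymptotic_to_id S T -> u != 0 ->
  exists f : dual X,
    [/\ forall x, `|f x| <= `|x|, step_monotone S T f & f u = `|u|].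
Proof.
move=> Sd sT aT u0; have nu0 : 0 < `|u| by rewrite normr_gt0.
(* The shift by 2 makes [e i < |u|] hold already at index 0. *)
pose e (i : seq X * nat) : R := `|u| / i.2.+2%:R.
have e0 i : 0 < e i by rewrite divr_gt0.
have eu i : e i < `|u| by rewrite ltr_pdivrMr// ltr_pMr// ltr1n.
have /choice[c cP] : forall i : seq X * nat,
    exists c, approx_step_functional S T u i.1 (e i) c.
  by move=> i; apply: (@approx_step_functional_exists _ _ S T u _ (e i)).
(* An ultrafilter finer than these tails eventually contains every finite set of vectors and sends
   [e] to 0, so the approximate identities become exact. *)
pose B (j : seq X * nat) := [set i : seq X * nat | {subset j.1 <= i.1} /\ (j.2 <= i.2)%N].
pose FB := filter_from setT B.
have FBf : ProperFilter FB.
  apply: filter_from_proper => [|j _]; last by exists j; split.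
  apply: filter_from_filter; first by exists ([::], 0%N).
  move=> j k _ _; exists (j.1 ++ k.1, maxn j.2 k.2) => // i [/= s n]; split; split => /=.
  - by move=> w wj; apply: s; rewrite mem_cat wj.
  - by rewrite (leq_trans _ n)// leq_maxl.
  - by move=> w wj; apply: s; rewrite mem_cat wj orbT.
  - by rewrite (leq_trans _ n)// leq_maxr.
have [U [UU FU]] := ultraFilterLemma FBf.
have Umem (s : seq X) : \forall i \near U, {subset s <= i.1}.
  by apply: FU; exists (s, 0%N) => // i [].
have Ue : e @ U --> (0 : R).
  apply/cvgrPdist_le => d d0.
  have : FB [set i | (Num.bound (`|u| / d) <= i.2)%N].
    by exists ([::], Num.bound (`|u| / d)) => // i [].
  move/FU; apply: filterS => i /= ni.
  rewrite sub0r normrN gtr0_norm// ler_pdivrMr// -ler_pdivrMl// mulrC.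
  have := @archi_boundP _ (`|u| / d) (divr_ge0 (normr_ge0 _) (ltW d0)).
  move=> /ltW/le_trans; apply; rewrite ler_nat.
  by rewrite (leq_trans ni)// ltnW// ltnW.
have /choice[f fU] : forall w, exists l : R, (fun i => c i w) @ U --> l.
  by move=> w; apply: (@bounded_ultra_cvg _ _ U _ _ `|w|) => i; case: (cP i).
have UeM b : (fun i => b * e i) @ U --> b * 0 by apply: cvgMr; exact: Ue.
have squeeze (a l b : R) (g : seq X * nat -> R) : g @ U --> l ->
    (\forall i \near U, `|g i - a| <= b * e i) -> l = a.
  move=> gl gab; apply/eqP; rewrite -subr_eq0 -normr_eq0 eq_le normr_ge0 andbT.
  have gal : (fun i => g i - a) @ U --> l - a.
    by apply: (cvgB gl); exact: cvg_cst.
  have gal' : (fun i => `|g i - a|) @ U --> `|l - a| by apply: cvg_norm gal.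
  by rewrite -(mulr0 b); apply: filter_ler_cvg gal' (UeM b) gab.
have fD v w : f (v + w) = f v + f w.
  apply/eqP; rewrite -subr_eq0; apply/eqP.
  have cl : (fun i => c i (v + w) - (c i v + c i w)) @ U --> f (v + w) - (f v + f w).
    by apply: cvgB; [exact: fU|apply: cvgD; exact: fU].
  apply: (squeeze 0 _ 3 _ cl); have := Umem [:: v; w; v + w]; apply: filterS => i s.
  case: (cP i) => _ _ + _ _; rewrite subr0; apply; apply: s; rewrite ?inE ?eqxx ?orbT//.
have f0 : f 0 = 0 by have := fD 0 0; rewrite addr0; lra.
have fpZ t w : 0 < t -> f (t *: w) = t * f w.
  move=> t0; apply/eqP; rewrite -subr_eq0; apply/eqP.
  have cl : (fun i => c i (t *: w) - t * c i w) @ U --> f (t *: w) - t * f w.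
    by apply: cvgB; [exact: fU|apply: cvgMr; exact: fU].
  apply: (squeeze 0 _ (1 + t) _ cl); have := Umem [:: w; t *: w]; apply: filterS => i s.
  case: (cP i) => _ _ _ + _; rewrite subr0; apply => //; apply: s; rewrite ?inE ?eqxx ?orbT//.
have fN w : f (- w) = - f w by have := fD w (- w); rewrite subrr f0; lra.
have fZ t w : f (t *: w) = t * f w.
  have [t0|t0|->] := ltgtP t 0; last by rewrite scale0r f0 mul0r.
    by have := fpZ (- t) w; rewrite oppr_gt0 => /(_ t0); rewrite scaleNr fN; lra.
  exact: fpZ.
have fle w : `|f w| <= `|w|.
  have nP : (fun i => `|c i w|) @ U --> `|f w| by apply: cvg_norm (fU w).
  by apply: (cvgr_to_le nP); apply: filterE => i; case: (cP i).
have flin : linear (f : X -> R^o) by move=> a v w; rewrite fD fZ.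
have f1 w : `|f w| <= 1 * `|w| by rewrite mul1r.
have [g gf] := dual_of_bounded _ _ _ _ flin f1.
exists g; split => [x|x y n Sx Sy|]; rewrite !gf//; last first.
  apply/eqP; rewrite eq_le (le_trans (ler_norm _))//=.
  have : (fun i => `|u| - 2 * e i) @ U --> `|u| - 2 * 0.
    by apply: cvgB; [exact: cvg_cst|exact: UeM].
  rewrite mulr0 subr0 => h; apply: (filter_ler_cvg _ _ _ _ _ _ _ _ h (fU u)).
  by apply: filterE => i; case: (cP i).
move=> xy.
have lim4 : (fun i => c i x + n%:~R + 4 * e i - c i y) @ U --> f x + n%:~R + 4 * 0 - f y.
  by apply: cvgB; [apply: cvgD; [apply: cvgD; [exact: fU|exact: cvg_cst]|exact: UeM]|exact: fU].
have lim2 : (fun i => c i (T y) + 2 * e i) @ U --> f (T y) + 2 * 0.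
  by apply: cvgD; [exact: fU|exact: UeM].
have lim1 : (fun i => c i (T x) + n%:~R) @ U --> f (T x) + n%:~R.
  by apply: cvgD; [exact: fU|exact: cvg_cst].
rewrite -[f (T y)]addr0 -(mulr0 2); apply: (filter_ler_cvg _ _ _ _ _ _ _ _ lim1 lim2).
(* The strict hypothesis outlasts the vanishing margin [4 * e i]; the conclusion, being weak, passes
   to the limit. *)
have lt0 : f x + n%:~R + 4 * 0 - f y < 0 by lra.
have h4 : \forall i \near U, c i x + n%:~R + 4 * e i - c i y < 0.
  by apply: (cvgr_lt _ lim4).
move: h4 (Umem [:: x; y; T x; T y]); apply: filterS2 => i h s.
by case: (cP i) => _ _ _ _; apply => //; lra.
Qed.

Definition step_functional {R : realType} {X : normedModType R} (S : set X)
    (T : X -> X) (f : dual X) :=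
  (forall x, `|f x| <= `|x|) /\ step_monotone S T f.

(** Step-monotonicity has an open hypothesis and a closed conclusion, so it survives pointwise
    limits. *)
Lemma step_functional_limit (R : realType) (X : normedModType R) (S : set X)
    (T : X -> X) (I : Type) (U : set_system I) (UU : UltraFilter U)
    (f : I -> dual X) :
  (forall i, step_functional S T (f i)) ->
  exists2 F, step_functional S T F & forall x, (fun i => f i x) @ U --> F x.
Proof.
move=> sf.
have /choice[F fF] : forall x, exists l : R, (fun i => f i x) @ U --> l.
  by move=> x; apply: (@bounded_ultra_cvg _ _ U _ _ `|x|) => i; case: (sf i).
have Flin : linear (F : X -> R^o).
  move=> a x y; apply/esym; apply: norm_cvg_unique (fF _).
  have -> : (fun i => f i (a *: x + y)) = (fun i => a * f i x + f i y).
    by apply/funext => i; rewrite linearP.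
  by apply: cvgD (fF y); apply: cvgMr (fF x).
have F1 x : `|F x| <= 1 * `|x|.
  have nP : (fun i => `|f i x|) @ U --> `|F x| by apply: cvg_norm (fF x).
  by rewrite mul1r; apply: (cvgr_to_le nP); apply: filterE => i; case: (sf i).
have [G GF] := dual_of_bounded _ _ _ _ Flin F1.
exists G; last by move=> x; rewrite GF.
split=> [x|x y n Sx Sy]; rewrite !GF; first by rewrite -[`|x|]mul1r.
move=> xy.
have lim0 : (fun i => f i x + n%:~R - f i y) @ U --> F x + n%:~R - F y.
  by apply: cvgB; [apply: cvgD; [exact: fF|exact: cvg_cst]|exact: fF].
have lim1 : (fun i => f i (T x) + n%:~R) @ U --> F (T x) + n%:~R.
  by apply: cvgD; [exact: fF|exact: cvg_cst].
apply: (filter_ler_cvg _ _ _ _ _ _ _ _ lim1 (fF (T y))).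
have lt0 : F x + n%:~R - F y < 0 by rewrite subr_lt0.
have h0 : \forall i \near U, f i x + n%:~R - f i y < 0 by apply: (cvgr_lt _ lim0).
by apply: filterS h0 => i; rewrite subr_lt0; case: (sf i) => _; apply.
Qed.

(** * The displacement [T x - x] *)

Lemma displacement_bound (R : realType) (X : normedModType R) (S : set X)
    (T : X -> X) (x y : X) :
  dense S -> step_preserving S T -> asymptotic_to_id S T -> S x -> S y ->
  `|(T x - x) - (T y - y)| <= 1.
Proof.
move=> Sd sT aT Sx Sy; set w := _ - _.
have [->|w0] := eqVneq w 0; first by rewrite normr0.
have [f [_ fm fw]] := @step_functional_exists _ _ S T w Sd sT aT w0.
(* This is the largest integer with [f x + n < f y]; rounding loses at most 1, which is the
   bound. *)
pose n := Num.ceil (f y - f x) - 1.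
have nlt : f x + n%:~R < f y.
  have := ceilB1_lt (f y - f x); rewrite /n; lra.
have := fm x y n Sx Sy nlt.
rewrite -fw /w !linearB /= /n intrD.
have := ceil_ge (f y - f x); lra.
Qed.

(* D x is a weak limit of displacements along points of S tending to x from the
   direction e; on that side the monotone function f x |-> f (T x) takes its
   one-sided limit, so that f (D x) depends on f x only, even where it jumps. *)
Lemma displacement_extension (R : realType) (X : normedModType R) (S : set X)
    (T : X -> X) (e : X) :
  reflexive_space X -> dense S -> step_preserving S T -> asymptotic_to_id S T ->
  exists (D : X -> X) (C : R), (forall x, `|D x| <= C) /\
    forall f, step_functional S T f -> 0 < f e ->
    [/\ forall x x', f x = f x' -> f (D x) = f (D x'),
        forall x z, S x -> f x < f z -> f (T x) <= f z + f (D z) &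
        forall x z, S x -> f z < f x -> f z + f (D z) <= f (T x)].
Proof.
move=> Xr Sd sT aT.
have [U [UU FU]] := @ultraFilterLemma _ (\oo) _.
pose h (k : nat) : R := k.+1%:R^-1.
have h0 k : 0 < h k by rewrite invr_gt0.
have hU : h @ U --> (0 : R) by apply: cvg_trans (@cvg_harmonic R); apply: cvg_app.
(* The error [h k ^+ 2] is of smaller order than the shift [h k * f e], so [f (y (x, k))] finally
   exceeds [f x] whenever [0 < f e]. *)
have /choice[y yP] : forall xk : X * nat, exists s,
    S s /\ `|s - (xk.1 + h xk.2 *: e)| < h xk.2 ^+ 2.
  move=> [x k]; have [] := @dense_approx _ _ S (x + h k *: e) (h k ^+ 2) Sd.
    by rewrite exprn_gt0.
  by move=> s Ss sk; exists s.
have [s0 Ss0 _] := @dense_approx _ _ S 0 1 Sd ltr01.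
pose C := 1 + `|T s0 - s0|.
have dC s : S s -> `|T s - s| <= C.
  move=> Ss; have := displacement_bound _ _ _ _ _ _ Sd sT aT Ss Ss0.
  have := ler_normD ((T s - s) - (T s0 - s0)) (T s0 - s0).
  by rewrite subrK /C; lra.
have yS x k : S (y (x, k)) by case: (yP (x, k)).
have /choice[D DP] : forall x, exists D : X, forall f : dual X,
    (fun k => f (T (y (x, k)) - y (x, k))) @ U --> f D.
  by move=> x; apply: (@weak_ultra_limit _ _ _ U _ _ C Xr) => k; apply: dC.
have fy (f : dual X) x k : (forall x, `|f x| <= `|x|) ->
    `|f (y (x, k)) - (f x + h k * f e)| <= h k ^+ 2.
  move=> f1; have [_ /ltW] := yP (x, k); apply: le_trans.
  have -> : f x + h k * f e = f (x + h k *: e) by rewrite linearD linearZ.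
  by rewrite -linearB; exact: f1.
have fylim (f : dual X) x : (forall x, `|f x| <= `|x|) ->
    (fun k => f (y (x, k))) @ U --> f x.
  move=> f1.
  have lim1 : (fun k => h k * (1 + `|f e|)) @ U --> (0 : R).
    by rewrite -[X in _ --> X](mul0r (1 + `|f e|)); apply: cvgMl; exact: hU.
  apply/cvgrPdist_le => d d0.
  have hd : \forall k \near U, h k * (1 + `|f e|) < d by apply: (cvgr_lt _ lim1).
  apply: filterS hd => k hd; apply: le_trans (ltW hd).
  have := ler_distD (f x + h k * f e) (f x) (f (y (x, k))).
  have := fy f x k f1; rewrite [`|f (y _) - _|]distrC.
  rewrite opprD addrA subrr add0r normrN normrM gtr0_norm//.
  have : h k ^+ 2 <= h k.
    by rewrite expr2 ler_piMr ?(ltW (h0 k))// /h invf_le1 ?ler1n.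
  lra.
have fTlim (f : dual X) x : (forall x, `|f x| <= `|x|) ->
    (fun k => f (T (y (x, k)))) @ U --> f x + f (D x).
  move=> f1.
  have : (fun k => f (y (x, k)) + f (T (y (x, k)) - y (x, k))) @ U --> f x + f (D x).
    by apply: cvgD; [exact: fylim|exact: DP].
  by under eq_fun do rewrite -linearD addrC subrK.
exists D, C; split=> [x|f [f1 fm] fe].
  have [->|Dx0] := eqVneq (D x) 0.
    by rewrite normr0 (le_trans _ (dC _ Ss0)).
  have [f [f1 _ <-]] := @step_functional_exists _ _ S T _ Sd sT aT Dx0.
  apply: (cvgr_to_le (DP x f)); apply: filterE => k.
  by rewrite (le_trans (ler_norm _))// (le_trans (f1 _))// dC.
have up x z : S x -> f x < f z -> f (T x) <= f z + f (D z).
  move=> Sx xz; apply: (cvgr_to_ge (fTlim f z f1)).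
  have hz : \forall k \near U, f x < f (y (z, k)) by apply: (cvgr_gt _ (fylim f z f1)).
  apply: filterS hz => k hz; have := fm x (y (z, k)) 0 Sx (yS _ _).
  by rewrite !addr0; apply.
have dn x z : S x -> f z < f x -> f z + f (D z) <= f (T x).
  move=> Sx zx; apply: (cvgr_to_le (fTlim f z f1)).
  have hz : \forall k \near U, f (y (z, k)) < f x by apply: (cvgr_lt _ (fylim f z f1)).
  apply: filterS hz => k hz; have := fm (y (z, k)) x 0 (yS _ _) Sx.
  by rewrite !addr0; apply.
(* For small [h k], the point [y (x', k)] lies strictly above the common value [f x], so [dn]
   applies to it with [z := x]. *)
have half x x' : f x = f x' -> f (D x) <= f (D x').
  move=> xx'; rewrite -(lerD2l (f x)) [in leRHS]xx'.
  apply: (cvgr_to_ge (fTlim f x' f1)).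
  have hz : \forall k \near U, h k < f e by apply: (cvgr_lt _ hU).
  apply: filterS hz => k hk; apply: dn => //.
  have := fy f x' k f1; rewrite xx' ler_norml => /andP[+ _].
  have : h k ^+ 2 < h k * f e by rewrite expr2 ltr_pM2l.
  lra.
split=> // x x' xx'; apply/eqP; rewrite eq_le half// half//.
Qed.

(** Iterating gives [psi (t + s *+ n) = psi t + d *+ n], which is unbounded in [n] unless
    [d = 0]. *)
Lemma bounded_equal_increments (R : realType) (psi : R -> R) (s C : R) :
  (forall t, `|psi t| <= C) ->
  (forall t c, psi (t + c + s) - psi (t + c) = psi (t + s) - psi t) ->
  forall t, psi (t + s) = psi t.
Proof.
move=> bd inc t; set d := psi (t + s) - psi t.
have iter n : psi (t + s *+ n) = psi t + d *+ n.
  elim: n => [|n IH]; first by rewrite !mulr0n !addr0.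
  rewrite !mulrSr !addrA -IH /d; have := inc t (s *+ n); lra.
apply/eqP; rewrite -subr_eq0 -/d -normr_eq0; apply/negPn/negP => dn0.
have d0 : 0 < `|d| by rewrite lt_neqAle eq_sym dn0 normr_ge0.
have C0 : 0 <= C by apply: le_trans (bd 0).
pose n := Num.bound (2 * C / `|d|).
have : 2 * C < n%:R * `|d|.
  by rewrite -ltr_pdivrMr//; apply: archi_boundP; rewrite divr_ge0// mulr_ge0.
have <- : `|psi (t + s *+ n) - psi t| = n%:R * `|d|.
  by rewrite iter addrAC subrr add0r normrMn mulr_natl.
have := ler_normB (psi (t + s *+ n)) (psi t); have := bd t; have := bd (t + s *+ n).
lra.
Qed.

(* If no finite set of the f n determines F, translate along vectors v m killing
   the first m of them and pass to a weak limit. Otherwise a minimal such set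
   makes the increments of psi, where F (D x) = psi (F x), translation invariant. *)
Lemma displacement_constant (R : realType) (X : normedModType R) (U : set_system nat)
    (UU : UltraFilter U) (D : X -> X) (C : R) (f : nat -> dual X) (F : dual X) :
  reflexive_space X -> \oo `<=` U -> (forall x, `|D x| <= C) ->
  (forall n x x', f n x = f n x' -> f n (D x) = f n (D x')) ->
  (forall x x', F x = F x' -> F (D x) = F (D x')) ->
  (forall x, (fun n => f n x) @ U --> F x) ->
  (forall n, exists2 v, f n v = 0 & F v = 1) ->
  forall x y, F (D x) = F (D y).
Proof.
move=> Xr FU DC fD FD fF fv.
pose P m := exists v, (forall n, (n < m)%N -> f n v = 0) /\ F v = 1.
have [AP|nAP] := pselect (forall m, P m).
  move=> x y; have /choice[v vP] := AP.
  (* The translated point agrees with [x] under [f n] for [n < m] and with [y] under [F]. Hence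
     [f n W = f n (D x)] for all [n], while [F W = F (D y)]; letting [n] run along [U] identifies
     the two values. *)
  pose w m := D (x + F (y - x) *: v m).
  have [W wW] := @weak_ultra_limit _ _ _ U UU w C Xr (fun m => DC _).
  have fW n : f n W = f n (D x).
    apply: norm_cvg_unique (wW (f n)) _.
    apply: cvg_near_cst.
    have : \forall m \near U, (n < m)%N by apply: FU; exists n.+1.
    apply: filterS => m nm; apply: fD; rewrite linearD /= dual_linearZ.
    by case: (vP m) => ->// _; rewrite mulr0 addr0.
  have FW : F W = F (D y).
    apply: norm_cvg_unique (wW F) _.
    have -> : (fun i => F (w i)) = fun=> F (D y); last exact: cvg_cst.
    apply/funext => m; apply: FD; rewrite linearD /= dual_linearZ.
    by case: (vP m) => _ ->; rewrite linearB /= mulr1 addrC subrK.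
  rewrite -FW; apply: norm_cvg_unique (fF W).
  have -> : (fun n => f n W) = fun n => f n (D x) by apply/funext => n.
  exact: fF.
(* Since [P m.+1] fails, [F] vanishes wherever [f 0] to [f m] all do; [v1] is killed by all of these
   but possibly [f m]. *)
have [m [[v1 [fv1 Fv1]] nP]] : exists m, P m /\ ~ P m.+1.
  apply: contrapT => nm; apply: nAP; elim => [|m Pm].
    by have [v _ Fv] := fv 0%N; exists v.
  by apply: contrapT => nPm; apply: nm; exists m.
have ker v : (forall n, (n <= m)%N -> f n v = 0) -> F v = 0.
  move=> fnv; apply: contrapT => /eqP Fv0; apply: nP; exists ((F v)^-1 *: v).
  split; last by rewrite dual_linearZ mulVf.
  by move=> n nm; rewrite dual_linearZ fnv// mulr0.
have [v2 fv2 Fv2] := fv m.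
pose psi t := F (D (t *: v2)).
have psiE x : F (D x) = psi (F x).
  by apply: FD; rewrite dual_linearZ Fv2 mulr1.
have psi_const s t : psi (t + s) = psi t.
  apply: (@bounded_equal_increments _ psi s (`|F| * C)) => [r|r c].
    by rewrite (le_trans (dual_norm_le F _))// ler_wpM2l// dual_norm_ge0.
  (* The first [m] functionals kill [w x], and [f m] takes the same value at all [w (r *: v2)]
     because it kills [v2]. So [F] agrees at them too. *)
  pose w x := D (x + s *: v1) - D x.
  have Fw x : F (w x) = psi (F x + s) - psi (F x).
    by rewrite /w linearB /= !psiE linearD /= dual_linearZ Fv1 mulr1.
  have Fr a : F (a *: v2) = a by rewrite dual_linearZ Fv2 mulr1.
  have := Fw (r *: v2); have := Fw ((r + c) *: v2); rewrite !Fr => <- <-.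
  apply/eqP; rewrite -subr_eq0 -linearB; apply/eqP; apply: ker => n nm.
  rewrite linearB; apply/eqP; rewrite subr_eq0; apply/eqP.
  move: nm; rewrite leq_eqVlt => /orP[/eqP ->|nm].
    rewrite /w !linearB /=; congr (_ - _); apply: fD.
      by rewrite !linearD /= !dual_linearZ fv2 !mulr0.
    by rewrite !dual_linearZ fv2 !mulr0.
  have fw x : f n (w x) = 0.
    rewrite /w linearB; apply/eqP; rewrite subr_eq0; apply/eqP; apply: fD.
    by rewrite linearD /= dual_linearZ fv1// mulr0 addr0.
  by rewrite /= !fw.
move=> x y; rewrite !psiE.
by have := psi_const (F y - F x) (F x); rewrite addrC subrK.
Qed.

(** * Strict convexity and the lower bound for distances *)

(** The midpoint of the two normalised vectors has value 1 under [f], hence norm 1; being extreme,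
    it equals both. *)
Lemma strictly_convex_norming (R : realType) (X : normedModType R) (f : dual X)
    (a b : X) : strictly_convex X -> (forall x, `|f x| <= `|x|) ->
  a != 0 -> b != 0 -> f a = `|a| -> f b = `|b| -> `|b| *: a = `|a| *: b.
Proof.
move=> sc f1 a0 b0 fa fb.
have na : 0 < `|a| by rewrite normr_gt0.
have nb : 0 < `|b| by rewrite normr_gt0.
pose y := `|a|^-1 *: a; pose z := `|b|^-1 *: b.
have ny : `|y| = 1 by rewrite normrZ gtr0_norm ?invr_gt0// mulVf ?gt_eqF.
have nz : `|z| = 1 by rewrite normrZ gtr0_norm ?invr_gt0// mulVf ?gt_eqF.
have fy : f y = 1 by rewrite dual_linearZ fa mulVf ?gt_eqF.
have fz : f z = 1 by rewrite dual_linearZ fb mulVf ?gt_eqF.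
pose x := 2^-1 *: y + (1 - 2^-1) *: z.
have nx : `|x| = 1.
  apply/eqP; rewrite eq_le; apply/andP; split.
    rewrite (le_trans (ler_normD _ _))// (normrZ 2^-1) (normrZ (1 - 2^-1)) ny nz !ger0_norm; lra.
  rewrite (le_trans _ (f1 x))// (le_trans _ (ler_norm _))//.
  rewrite linearD /= (dual_linearZ _ _ f 2^-1) (dual_linearZ _ _ f (1 - 2^-1)) fy fz; lra.
have [_ ext] := sc x nx.
have half : 0 < (2^-1 : R) < 1 by apply/andP; split; lra.
have le1 (v : X) : `|v| = 1 -> `|v| <= 1 by move=> ->.
have [yx zx] := ext y z 2^-1 (le1 _ ny) (le1 _ nz) half erefl.
have : y = z by rewrite yx zx.
rewrite /y /z => /(congr1 (fun v => (`|a| * `|b|) *: v)).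
rewrite !scalerA [`|a| * `|b|]mulrC mulfK ?gt_eqF// => ->.
by rewrite mulrC mulfK// gt_eqF.
Qed.

(** If both independent vectors were multiples of [u], cross-multiplying their coefficients would
    give a nontrivial relation. *)
Lemma independent_vector (R : realType) (X : lmodType R) (u : X) :
  dimension_ge X 2 -> exists e : X, forall a b : R, a *: u + b *: e = 0 -> b = 0.
Proof.
move=> [e ind]; apply: contrapT => none.
have mul i : exists c : R, e i = c *: u.
  apply: contrapT => nc; apply: none; exists (e i) => a b abe.
  apply: contrapT => /eqP b0; apply: nc; exists (- (a / b)).
  have : b^-1 *: (a *: u + b *: e i) = 0 by rewrite abe scaler0.
  rewrite scalerDr !scalerA mulVf// scale1r mulrC => /eqP.
  by rewrite addrC addr_eq0 scaleNr => /eqP.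
have [c0 e0] := mul 0; have [c1 e1] := mul 1.
pose c (i : 'I_2) := if i == 0 then c1 else - c0.
have /ind ci : \sum_(i < 2) c i *: e i = 0.
  rewrite big_ord_recl big_ord1 /c /= (_ : lift _ _ = 1); last exact/val_inj.
  by rewrite e0 e1 !scalerA -scalerDl mulNr mulrC subrr scale0r.
have /eqP := ci 1; rewrite /c /= oppr_eq0 => /eqP c00.
pose d (i : 'I_2) : R := if i == 0 then 1 else 0.
have /ind di : \sum_(i < 2) d i *: e i = 0.
  by rewrite big_ord_recl big_ord1 /d /= e0 c00 !scale0r scaler0 addr0.
by have /eqP := di 0; rewrite /d /= oner_eq0.
Qed.

Lemma step_noncontractive (R : realType) (X : normedModType R) (S : set X)
    (T : X -> X) :
  strictly_convex X -> reflexive_space X -> dimension_ge X 2 -> dense S ->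
  step_preserving S T -> asymptotic_to_id S T ->
  forall x y, S x -> S y -> `|x - y| <= `|T x - T y|.
Proof.
move=> Xs Xr Xd Sd sT aT x y Sx Sy; set u := x - y.
have [->|u0] := eqVneq u 0; first by rewrite normr0.
have nu0 : 0 < `|u| by rewrite normr_gt0.
have [e ind] := @independent_vector _ _ u Xd.
have e0 : e != 0.
  apply/eqP => e0; have := oner_neq0 R; rewrite (ind 0 1) ?eqxx//.
  by rewrite scale0r add0r e0 scaler0.
have ne0 : 0 < `|e| by rewrite normr_gt0.
(* The factor [1 / 3] gives [|un n - u| <= |u| / 3], hence [f n u >= |u| / 3 > 0]. *)
pose r n : R := `|u| / 3 / `|e| * n.+1%:R^-1.
have r0 n : 0 < r n by rewrite mulr_gt0 ?invr_gt0// !divr_gt0.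
pose un n := u + r n *: e.
have unu n : `|un n - u| = `|u| / 3 * n.+1%:R^-1.
  rewrite /un addrAC subrr add0r normrZ gtr0_norm// /r.
  by rewrite mulrAC divfK ?gt_eqF.
have unu3 n : `|un n - u| <= `|u| / 3.
  by rewrite unu ler_piMr// ?invf_le1 ?ler1n// divr_ge0.
have un0 n : un n != 0.
  apply/eqP => unE; have /ind rn : 1 *: u + r n *: e = 0 by rewrite scale1r.
  by have := r0 n; rewrite rn ltxx.
have /choice[f fP] : forall n, exists f : dual X, step_functional S T f /\ f (un n) = `|un n|.
  move=> n; have [f [f1 f2 f3]] := @step_functional_exists _ _ S T _ Sd sT aT (un0 n).
  by exists f.
have [U [UU FU]] := @ultraFilterLemma _ (\oo) _.
have [F sF fF] := @step_functional_limit _ _ S T _ U UU f (fun n => (fP n).1).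
have fu n : `|u| - 2 * `|un n - u| <= f n u.
  have [[f1 _] fn] := fP n.
  have := f1 (un n - u); rewrite linearB /= fn ler_norml => /andP[_].
  have := lerB_dist u (un n); rewrite distrC; lra.
have Fu : F u = `|u|.
  apply/eqP; rewrite eq_le (le_trans (ler_norm _) (sF.1 _))/=.
  have lim0 : (fun n => `|u| - 2 * `|un n - u|) @ U --> `|u| - 2 * (`|u| / 3 * 0).
    apply: cvgB; first exact: cvg_cst.
    apply: cvgMr; under eq_fun do rewrite unu; apply: cvgMr.
    by apply: cvg_trans (@cvg_harmonic R); apply: cvg_app.
  rewrite !mulr0 subr0 in lim0.
  by apply: (filter_ler_cvg _ _ _ _ _ _ _ _ lim0 (fF u)); apply: filterE.
have fu0 n : 0 < f n u by have := fu n; have := unu3 n; lra.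
have fv n : exists2 v, f n v = 0 & F v = 1.
  have [[f1 _] fn] := fP n.
  have nun : 0 < `|un n| by rewrite normr_gt0.
  (* This is [u] projected along [un n] onto the kernel of [f n]. Strict convexity gives
     [f n u < |u| = F u], so [F v > 0]. *)
  pose v := u - (f n u / `|un n|) *: un n.
  have fv : f n v = 0 by rewrite /v linearB /= dual_linearZ fn divfK ?gt_eqF// subrr.
  have fltu : f n u < `|u|.
    rewrite lt_neqAle (le_trans (ler_norm _) (f1 _)) andbT; apply/eqP => fnu.
    have := strictly_convex_norming _ _ _ _ _ Xs f1 (un0 n) u0 fn fnu.
    rewrite /un scalerDr addrC => /eqP; rewrite -subr_eq0 -addrA -scalerBl addrC scalerA => /eqP/ind.
    by move/eqP; rewrite mulf_eq0 !gt_eqF.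
  have Fv : 0 < F v.
    rewrite /v linearB /= dual_linearZ Fu subr_gt0.
    apply: le_lt_trans fltu.
    rewrite mulrAC -mulrA ler_piMr ?(ltW (fu0 n))// ler_pdivrMr// mul1r.
    by rewrite (le_trans (ler_norm _))// sF.1.
  exists ((F v)^-1 *: v); first by rewrite dual_linearZ fv mulr0.
  by rewrite dual_linearZ mulVf// gt_eqF.
have [D [C [DC DP]]] := @displacement_extension _ _ S T u Xr Sd sT aT.
have FuP : 0 < F u by rewrite Fu.
have [FD Fup Fdn] := DP F sF FuP.
have fD n a b : f n a = f n b -> f n (D a) = f n (D b).
  by have [+ _ _] := DP (f n) (fP n).1 (fu0 n); apply.
have FDc := displacement_constant _ _ U UU D C f F Xr FU DC fD FD fF fv.
(* Shifting [a] by [d / |u|] along [u] changes [F] by [d]; the two one-sided bounds then squeeze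
   [F (T a)]. *)
have FT a : S a -> F (T a) = F a + F (D 0).
  move=> Sa; apply/eqP; rewrite eq_le; apply/andP; split; apply/ler_addgt0Pr => d d0.
    have := Fup a (a + (d / `|u|) *: u) Sa.
    rewrite (FDc _ 0) linearD /= dual_linearZ Fu divfK ?gt_eqF// ltrDl => /(_ d0); lra.
  have := Fdn a (a - (d / `|u|) *: u) Sa.
  rewrite (FDc _ 0) linearB /= dual_linearZ Fu divfK ?gt_eqF// gtrBl => /(_ d0); lra.
have -> : `|u| = F (T x - T y).
  by rewrite linearB /= !FT// -Fu /u linearB /=; lra.
by rewrite (le_trans (ler_norm _))// sF.1.
Qed.

(** * Reduction to maps asymptotic to the identity, and conclusion *)

Lemma step_isometry_inverse (R : realType) (X : normedModType R) (S : set X)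
    (T : X -> X) : step_isometry S T ->
  exists T' : X -> X, [/\ step_isometry S T',
    forall x, S x -> T' (T x) = x & forall x, S x -> T (T' x) = x].
Proof.
move=> [[TS Tinj Tsurj] Tfl].
have /choice[T' T'P] : forall y, exists x, S y -> S x /\ T x = y.
  move=> y; have [Sy|nSy] := pselect (S y); last by exists y.
  by have [x Sx <-] := Tsurj y Sy; exists x.
have T'S x : S x -> S (T' x) by move=> /T'P[].
have TT' x : S x -> T (T' x) = x by move=> /T'P[].
have T'T x : S x -> T' (T x) = x.
  move=> Sx; have STx := TS _ Sx.
  by apply: Tinj; [exact: mem_set (T'S _ STx)|exact: mem_set|exact: TT'].
exists T'; split => //; split; last first.
  by move=> x y Sx Sy; rewrite (Tfl (T' x) (T' y)) ?TT'//; exact: T'S.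
split => //.
- by move=> x y; rewrite !inE => Sx Sy xy; rewrite -[x]TT'// xy TT'.
- by move=> x Sx; exists (T x); [exact: TS|exact: T'T].
Qed.

Lemma floor_eq_dist (R : realType) (a b : R) :
  Num.floor a = Num.floor b -> `|a - b| <= 1.
Proof.
move=> ab; have := floor_le a; have := floor_le b.
have := floorD1_gt a; have := floorD1_gt b.
rewrite ab !intrD ler_norml => ? ? ? ?; apply/andP; split; lra.
Qed.

(** [V] is the isometry near [T' \o s], where [s] rounds points to [S]; then [V (T x)] is close to
    [T' (s (T x))], which is within a constant of [x]. *)
Lemma step_isometry_straighten (R : realType) (X : completeNormedModType R)
    (S : set X) (T : X -> X) : dense S -> step_isometry S T ->
  exists V : X -> X, (forall x y, `|V x - V y| = `|x - y|) /\
    asymptotic_to_id S (V \o T).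
Proof.
move=> Sd stepT; have [T' [stepT' T'T TT']] := step_isometry_inverse _ _ _ _ stepT.
have near1 (Q : X -> X) : step_isometry S Q -> forall a b, S a -> S b ->
    `| `|Q a - Q b| - `|a - b| | <= 1.
  by move=> [_ Q1] a b Sa Sb; apply: floor_eq_dist; apply/esym/Q1.
have hT := near1 _ stepT; have hT' := near1 _ stepT'.
have TS x : S x -> S (T x) by case: stepT => -[+ _ _] _; apply.
have T'S x : S x -> S (T' x) by case: stepT' => -[+ _ _] _; apply.
have h2 : 0 < (2^-1 : R) by lra.
(* Rounding by [2^-1] changes distances by at most 1, and [T] or [T'] by at most 1 more: hence the
   coarse constant 2. *)
have /choice[s sP] : forall x : X, exists s, S s /\ `|s - x| < 2^-1.
  by move=> x; have [s Ss sx] := dense_approx _ _ S x _ Sd h2; exists s.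
have sS x : S (s x) by case: (sP x).
have sx x : `|s x - x| <= 2^-1 by case: (sP x) => _ /ltW.
have ss x y : `| `|s x - s y| - `|x - y| | <= 1.
  rewrite (le_trans (ler_dist_dist _ _))//.
  have -> : s x - s y - (x - y) = (s x - x) - (s y - y).
    by rewrite !opprB addrACA [RHS]addrACA [- x - s y]addrC.
  rewrite (le_trans (ler_normB _ _))//; have := sx x; have := sx y; lra.
have ci (Q : X -> X) : (forall a b, S a -> S b -> `| `|Q a - Q b| - `|a - b| | <= 1) ->
    forall x y, `| `|Q (s x) - Q (s y)| - `|x - y| | <= 2.
  move=> hQ x y; have := hQ _ _ (sS x) (sS y); have := ss x y.
  by rewrite !ler_norml => /andP[? ?] /andP[? ?]; apply/andP; split; lra.
have inv (P Q : X -> X) : (forall a b, S a -> S b -> `| `|Q a - Q b| - `|a - b| | <= 1) ->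
    (forall x, S x -> S (P x)) -> (forall x, S x -> Q (P x) = x) ->
    forall x, `|Q (s (P (s x))) - x| <= 2.
  move=> hQ PS QP x; have := hQ _ _ (sS (P (s x))) (PS _ (sS x)).
  rewrite QP// ler_norml => /andP[_].
  have := ler_distD (s x) (Q (s (P (s x)))) x.
  have := sx x; have := sx (P (s x)); lra.
have cT : coarse_isometry 2 (T' \o s) (T \o s).
  by split; [exact: (ci T' hT')|exact: (ci T hT)|exact: (inv T T' hT' TS T'T)|
    exact: (inv T' T hT T'S TT')].
have [V [Viso Vg]] := coarse_isometry_near_isometry _ _ _ _ _ cT.
exists V; split => // eta eta0; have [C CP] := Vg eta eta0.
exists (eta * (`|s 0| + 1 + `|T (s 0)|) + C + 2) => x Sx /=.
have := ler_distD (T' (s (T x))) (V (T x)) x; rewrite (distrC (V _) (T' _)).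
have := CP (T x) => /=.
have := hT' _ _ (sS (T x)) (TS _ Sx); rewrite T'T// ler_norml => /andP[_].
have := sx (T x).
have nTx : `|T x| <= `|x| + (`|s 0| + 1 + `|T (s 0)|).
  have := hT _ _ Sx (sS 0); rewrite ler_norml => /andP[_].
  have := ler_normD (T x - T (s 0)) (T (s 0)); rewrite subrK.
  have := ler_normB x (s 0); lra.
have : eta * `|T x| <= eta * (`|x| + (`|s 0| + 1 + `|T (s 0)|)) by rewrite ler_pM2l.
lra.
Qed.

Lemma step_isometry_noncontractive (R : realType) (X : completeNormedModType R)
    (S : set X) (T : X -> X) :
  strictly_convex X -> reflexive_space X -> dimension_ge X 2 -> dense S ->
  step_isometry S T -> forall x y, S x -> S y -> `|x - y| <= `|T x - T y|.
Proof.
move=> Xs Xr Xd Sd stepT x y Sx Sy.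
have [V [Viso aVT]] := step_isometry_straighten _ _ _ _ Sd stepT.
rewrite -[leRHS]Viso; apply: (@step_noncontractive _ _ S (V \o T)) => //.
move=> a b N Sa Sb /=; rewrite Viso.
by case: stepT => _ Tfl; rewrite -!floor_lt_int Tfl.
Qed.

Theorem theorem3 (R : realType) (X : completeNormedModType R)
    (Xstrict : strictly_convex X) (Xrefl : reflexive_space X)
    (Xdim : dimension_ge X 2)
    (S : set X) (Sdense : dense S)
    (T : X -> X) (Tstep : step_isometry S T) :
  forall x y : X, S x -> S y -> `|T x - T y| = `|x - y|.
Proof.
move=> x y Sx Sy; apply/eqP; rewrite eq_le; apply/andP; split; last first.
  exact: (@step_isometry_noncontractive _ _ S T).
(* The inverse is a step-isometry too, and its lower bound is the missing upper bound for [T]. *)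
have [T' [T'step T'T _]] := step_isometry_inverse _ _ _ _ Tstep.
have TS z : S z -> S (T z) by case: Tstep => -[+ _ _] _; apply.
rewrite -[in leRHS](T'T x)// -[in leRHS](T'T y)//.
apply: (@step_isometry_noncontractive _ _ S T') => //; exact: TS.
Qed.
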